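(* The system $\mathbf{IntK_{\Box}}$ is a conservative extension of $\mathbf{MI_{\Box}}$: for every formula $\phi$ built from proposition letters, $\top$, $\wedge$, $\to$ and $\Box$, we have $\mathbf{IntK_{\Box}}\vdash\phi$ if and only if $\mathbf{MI_{\Box}}\vdash\phi$.
   Context: $\mathbf{MI_{\Box}}$ is derived by modus ponens from substitution instances of $p\to(q\to p)$, $(p\to(q\to r))\to((p\to q)\to(p\to r))$, $(p\wedge q)\to p$, $(p\wedge q)\to q$, $p\to(q\to(p\wedge q))$, $\top$, $\Box(p\wedge q)\leftrightarrow(\Box p\wedge\Box q)$, $\Box\top\leftrightarrow\top$, closed under the rule from $p\leftrightarrow q$ infer $\Box p\leftrightarrow\Box q$. $\mathbf{IntK_{\Box}}$ is the intuitionistic modal logic of Wolter and Zakharyaschev in the language of intuitionistic propositional logic with $\Box$; it proves $\Box(p\wedge q)\leftrightarrow(\Box p\wedge\Box q)$ and $\Box\top\leftrightarrow\top$, and it is sound and complete with respect to frames $(X,\leq,R)$ where $(X,\leq)$ is a poset and $R$ a relation with $R=({\leq}\circ R\circ{\leq})$ (where $x(R_1\circ R_2)z$ iff $\exists y$, $xR_1y$, $yR_2z$), with valuations assigning up-closed sets, intuitionistic connectives as in Kripke semantics and $x\Vdash\Box\phi$ iff every $y$ with $xRy$ satisfies $\phi$. *)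

(* Defs.v *)
(* Both calculi are over an arbitrary type [P] of proposition letters.  Axioms
   are given as schemas, i.e. as all substitution instances at once. *)

(* The language of MI_Box: letters, top, conjunction, implication, box. *)
Inductive mi_form (P : Type) : Type :=
| MVar (p : P)
| MTop
| MAnd (a b : mi_form P)
| MImp (a b : mi_form P)
| MBox (a : mi_form P).

(* The full language of intuitionistic propositional logic with box. *)
Inductive int_form (P : Type) : Type :=
| IVar (p : P)
| ITop
| IBot
| IAnd (a b : int_form P)
| IOr (a b : int_form P)
| IImp (a b : int_form P)
| IBox (a : int_form P).

Arguments MVar {P} p.
Arguments MTop {P}.
Arguments MAnd {P} a b.
Arguments MImp {P} a b.
Arguments MBox {P} a.

Arguments IVar {P} p.
Arguments ITop {P}.
Arguments IBot {P}.
Arguments IAnd {P} a b.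
Arguments IOr {P} a b.
Arguments IImp {P} a b.
Arguments IBox {P} a.

Definition MIff {P : Type} (a b : mi_form P) : mi_form P :=
  MAnd (MImp a b) (MImp b a).

Definition IIff {P : Type} (a b : int_form P) : int_form P :=
  IAnd (IImp a b) (IImp b a).

Inductive MI_Box {P : Type} : mi_form P -> Prop :=
| MI_K a b : MI_Box (MImp a (MImp b a))
| MI_S a b c :
    MI_Box (MImp (MImp a (MImp b c)) (MImp (MImp a b) (MImp a c)))
| MI_andl a b : MI_Box (MImp (MAnd a b) a)
| MI_andr a b : MI_Box (MImp (MAnd a b) b)
| MI_pair a b : MI_Box (MImp a (MImp b (MAnd a b)))
| MI_top : MI_Box MTop
| MI_box_and a b : MI_Box (MIff (MBox (MAnd a b)) (MAnd (MBox a) (MBox b)))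
| MI_box_top : MI_Box (MIff (MBox MTop) MTop)
| MI_mp a b : MI_Box (MImp a b) -> MI_Box a -> MI_Box b
| MI_congr a b : MI_Box (MIff a b) -> MI_Box (MIff (MBox a) (MBox b)).

(* The Wolter-Zakharyaschev presentation: intuitionistic propositional logic,
   the two box axioms, and the regularity rule. *)
Inductive IntK_Box {P : Type} : int_form P -> Prop :=
| IntK_K a b : IntK_Box (IImp a (IImp b a))
| IntK_S a b c :
    IntK_Box (IImp (IImp a (IImp b c)) (IImp (IImp a b) (IImp a c)))
| IntK_andl a b : IntK_Box (IImp (IAnd a b) a)
| IntK_andr a b : IntK_Box (IImp (IAnd a b) b)
| IntK_pair a b : IntK_Box (IImp a (IImp b (IAnd a b)))
| IntK_orl a b : IntK_Box (IImp a (IOr a b))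
| IntK_orr a b : IntK_Box (IImp b (IOr a b))
| IntK_case a b c :
    IntK_Box (IImp (IImp a c) (IImp (IImp b c) (IImp (IOr a b) c)))
| IntK_top : IntK_Box ITop
| IntK_bot a : IntK_Box (IImp IBot a)
| IntK_box_and a b :
    IntK_Box (IIff (IBox (IAnd a b)) (IAnd (IBox a) (IBox b)))
| IntK_box_top : IntK_Box (IBox ITop)
| IntK_mp a b : IntK_Box (IImp a b) -> IntK_Box a -> IntK_Box b
| IntK_reg a b : IntK_Box (IImp a b) -> IntK_Box (IImp (IBox a) (IBox b)).

Fixpoint embed {P : Type} (f : mi_form P) : int_form P :=
  match f with
  | MVar p => IVar p
  | MTop => ITop
  | MAnd a b => IAnd (embed a) (embed b)
  | MImp a b => IImp (embed a) (embed b)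
  | MBox a => IBox (embed a)
  end.

(* Main.v *)
Require Import Defs.
From Stdlib Require Import Setoid.

(** The theories of [MI_Box] (sets of formulas containing its theorems and
    closed under modus ponens), ordered by inclusion and with [x R y] iff [y]
    contains every [a] with [MBox a] in [x], form a Kripke frame for [IntK_Box].
    Without disjunction in the language the truth lemma needs no prime theories:
    implication and box are witnessed by the theories [{c | a -> c in x}] and
    [{c | box c in x}].  Hence an [IntK_Box]-theorem [embed phi] holds at the
    least theory, which is [MI_Box] itself. *)

(* The condition [R = (le o R o le)] is only required to the left, as
   [le o R <= R]; this suffices for up-closedness of the truth sets. *)
Record frame : Type := Frame {
  world : Type;
  le : world -> world -> Prop;
  acc : world -> world -> Prop;
  le_refl : forall x, le x x;
  le_trans : forall x y z, le x y -> le y z -> le x z;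
  le_acc : forall x y z, le x y -> acc y z -> acc x z
}.

Arguments le {f}.
Arguments acc {f}.

Fixpoint force {P : Type} (F : frame) (V : world F -> P -> Prop)
    (x : world F) (f : int_form P) : Prop :=
  match f with
  | IVar p => V x p
  | ITop => True
  | IBot => False
  | IAnd a b => force F V x a /\ force F V x b
  | IOr a b => force F V x a \/ force F V x b
  | IImp a b => forall y, le x y -> force F V y a -> force F V y b
  | IBox a => forall y, acc x y -> force F V y a
  end.

(** Persistence. Implication goes up by transitivity of [le]; for box, [le_acc] makes every
    successor of [y] a successor of [x]. *)
Lemma force_mono {P : Type} (F : frame) (V : world F -> P -> Prop)
    (HV : forall x y p, le x y -> V x p -> V y p) (f : int_form P) :
  forall x y, le x y -> force F V x f -> force F V y f.
Proof.
  induction f; simpl; intros x y Hxy H.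
  - eauto.
  - exact I.
  - exact H.
  - destruct H; eauto.
  - destruct H; eauto.
  - intros z Hyz. apply H. eapply le_trans; eauto.
  - intros z Hyz. apply H. eapply le_acc; eauto.
Qed.

Lemma IntK_sound {P : Type} (F : frame) (V : world F -> P -> Prop)
    (HV : forall x y p, le x y -> V x p -> V y p) (f : int_form P) :
  IntK_Box f -> forall x, force F V x f.
Proof.
  pose proof (force_mono F V HV) as mono.
  pose proof (le_refl F) as refl. pose proof (le_trans F) as trans.
  induction 1; simpl in *; intros x.
  (* Persistence carries [a] from [y] up to [z]; the pairing axiom uses it likewise. *)
  - intros y _ Ha z Hz _. eauto.
  - intros y _ H1 z Hz H2 t Ht Ha.
    exact (H1 t (trans _ _ _ Hz Ht) Ha t (refl t) (H2 t Ht Ha)).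
  - intros y _ [Ha _]. exact Ha.
  - intros y _ [_ Hb]. exact Hb.
  - intros y _ Ha z Hz Hb. eauto.
  - auto.
  - auto.
  - intros y _ H1 z Hz H2 t Ht [Ha | Hb]; eauto.
  - exact I.
  - intros y _ [].
  - split.
    + intros y _ H. split; intros z Hz; apply H; exact Hz.
    + intros y _ [Ha Hb] z Hz. auto.
  - auto.
  - eauto.
  - eauto.
Qed.

Definition theory {P : Type} (w : mi_form P -> Prop) : Prop :=
  (forall a, MI_Box a -> w a) /\ (forall a b, w (MImp a b) -> w a -> w b).

Lemma theory_MI_Box (P : Type) : theory (@MI_Box P).
Proof. split; [auto | exact MI_mp]. Qed.

Lemma theory_pair {P : Type} (w : mi_form P -> Prop) (a b : mi_form P) :
  theory w -> w a -> w b -> w (MAnd a b).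
Proof.
  intros [T M] Ha Hb. refine (M _ _ (M _ _ _ Ha) Hb). apply T, MI_pair.
Qed.

Lemma theory_fst {P : Type} (w : mi_form P -> Prop) (a b : mi_form P) :
  theory w -> w (MAnd a b) -> w a.
Proof. intros [T M]. apply M, T, MI_andl. Qed.

Lemma theory_snd {P : Type} (w : mi_form P -> Prop) (a b : mi_form P) :
  theory w -> w (MAnd a b) -> w b.
Proof. intros [T M]. apply M, T, MI_andr. Qed.

Lemma theory_weaken {P : Type} (w : mi_form P -> Prop) (a b : mi_form P) :
  theory w -> w b -> w (MImp a b).
Proof. intros [T M]. apply M, T, MI_K. Qed.

Lemma MI_imp_refl {P : Type} (a : mi_form P) : MI_Box (MImp a a).
Proof.
  refine (MI_mp _ _ (MI_mp _ _ (MI_S a (MImp a a) a) _) _); apply MI_K.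
Qed.

(* Applied to [w = MI_Box], this is the deduction theorem. *)
Lemma theory_imp {P : Type} (w : mi_form P -> Prop) (a : mi_form P) :
  theory w -> theory (fun c => w (MImp a c)).
Proof.
  intros W. pose proof W as [T M]. split.
  - intros c Hc. apply theory_weaken; auto.
  - intros b c Hbc Hb. refine (M _ _ (M _ _ _ Hbc) Hb). apply T, MI_S.
Qed.

(** If [a] implies [b], then [a] is equivalent to its conjunction with [b], so congruence applies
    and box distributes over the conjunction. *)
Lemma MI_reg {P : Type} (a b : mi_form P) :
  MI_Box (MImp a b) -> MI_Box (MImp (MBox a) (MBox b)).
Proof.
  intros H.
  pose proof (theory_MI_Box P) as W.
  assert (E : MI_Box (MIff a (MAnd a b))).
  { apply (theory_pair MI_Box); [exact W | | apply MI_andl].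
    apply (theory_pair _ a b (theory_imp _ a W)); [apply MI_imp_refl | exact H]. }
  apply MI_congr in E. apply (theory_fst MI_Box) in E; [| exact W].
  (* From here on, reason inside the theory of consequences of [MBox a]. *)
  pose proof (theory_imp _ (MBox a) W) as Wa.
  apply (theory_snd _ (MBox a) (MBox b) Wa).
  refine (proj2 Wa _ _ _ E).
  apply (proj1 Wa).
  exact (theory_fst MI_Box _ _ W (MI_box_and a b)).
Qed.

(** Theorems: [MTop] implies each of them, so regularity lifts the provable [MBox MTop]. Modus
    ponens: merge the two boxes into one and apply regularity to the implication from
    [MAnd (MImp a b) a] to [b]. *)
Lemma theory_box {P : Type} (w : mi_form P -> Prop) :
  theory w -> theory (fun c => w (MBox c)).
Proof.
  intros W. pose proof W as [T M].
  pose proof (theory_MI_Box P) as W0.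
  split.
  - intros a Ha. apply T.
    apply (MI_mp (MBox MTop)).
    + apply MI_reg, theory_weaken; auto.
    + exact (MI_mp _ _ (theory_snd MI_Box _ _ W0 MI_box_top) MI_top).
  - intros a b Hab Ha.
    apply (M (MBox (MAnd (MImp a b) a))).
    + apply T, MI_reg.
      pose proof (theory_imp _ (MAnd (MImp a b) a) W0) as Wc.
      exact (proj2 Wc _ _ (MI_andl _ _) (MI_andr _ _)).
    + apply (M (MAnd (MBox (MImp a b)) (MBox a))).
      * apply T. exact (theory_snd MI_Box _ _ W0 (MI_box_and _ _)).
      * apply theory_pair; auto.
Qed.

Definition theory_frame (P : Type) : frame.
Proof.
  refine {| world := {w : mi_form P -> Prop | theory w};
            le x y := forall a, proj1_sig x a -> proj1_sig y a;
            acc x y := forall a, proj1_sig x (MBox a) -> proj1_sig y a |};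
    auto.
Defined.

Definition theory_val (P : Type) (x : world (theory_frame P)) (p : P) : Prop :=
  proj1_sig x (MVar p).

Lemma truth {P : Type} (a : mi_form P) : forall x : world (theory_frame P),
  force (theory_frame P) (theory_val P) x (embed a) <-> proj1_sig x a.
Proof.
  induction a as [p | | a IHa b IHb | a IHa b IHb | a IHa]; simpl;
    intros [w W]; simpl; pose proof W as [T M].
  - apply iff_refl.
  - split; [intros _; apply T, MI_top | auto].
  - rewrite IHa, IHb. simpl. split.
    + intros [Ha Hb]. apply theory_pair; auto.
    + intros H. split; [eapply theory_fst | eapply theory_snd]; eauto.
  - split.
    + intros H.
      (* The least theory that extends [w] and contains [a]. *)
      specialize (H (exist _ _ (theory_imp w a W))).
      rewrite IHa, IHb in H. simpl in H. apply H.
      * intros c. apply theory_weaken. exact W.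
      * apply T, MI_imp_refl.
    + intros H [v [T' M']] Hv. rewrite IHa, IHb. simpl in *. eauto.
  - split.
    + intros H.
      (* The least [acc]-successor of [w]. *)
      specialize (H (exist _ _ (theory_box w W))).
      rewrite IHa in H. simpl in H. auto.
    + intros H y Hy. rewrite IHa. auto.
Qed.

(** Congruence is regularity applied to both directions of the equivalence. *)
Lemma embed_IntK {P : Type} (phi : mi_form P) :
  MI_Box phi -> IntK_Box (embed phi).
Proof.
  assert (pair : forall a b : int_form P,
    IntK_Box a -> IntK_Box b -> IntK_Box (IAnd a b)).
  { intros a b Ha Hb.
    exact (IntK_mp _ _ (IntK_mp _ _ (IntK_pair a b) Ha) Hb). }
  assert (weaken : forall a b : int_form P, IntK_Box b -> IntK_Box (IImp a b)).
  { intros a b. apply IntK_mp, IntK_K. }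
  induction 1 as [| | | | | | | | a b _ IH1 _ IH2 | a b _ IH]; simpl in *.
  - apply IntK_K.
  - apply IntK_S.
  - apply IntK_andl.
  - apply IntK_andr.
  - apply IntK_pair.
  - apply IntK_top.
  - apply IntK_box_and.
  - apply pair; apply weaken; [apply IntK_top | apply IntK_box_top].
  - exact (IntK_mp _ _ IH1 IH2).
  - apply pair; apply IntK_reg.
    + exact (IntK_mp _ _ (IntK_andl _ _) IH).
    + exact (IntK_mp _ _ (IntK_andr _ _) IH).
Qed.

Theorem theorem6p5 (P : Type) (phi : mi_form P) :
  IntK_Box (embed phi) <-> MI_Box phi.
Proof.
  split; [| apply embed_IntK].
  intros H.
  apply (truth phi (exist _ _ (theory_MI_Box P))).
  apply IntK_sound; [| exact H].
  (* The valuation is up-closed because [le] is inclusion. *)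
  intros x y p Hxy. apply Hxy.
Qed.
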